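(* Let $b\ge2$, $n,d\ge1$ and $k\ge0$ be integers and let $\omega$ be a primitive $d$th root of unity. (a) If $d\mid n$ then $$\genfrac{[}{]}{0pt}{}{n}{k}_\omega^{(b)}=\sum_{\substack{|\lambda|=k\\ d\mid\lambda_i\text{ for all }i}}z_\lambda^{-1}(1-b)^{l_b(\lambda)}n^{l(\lambda)}=\sum_{|\mu|=k/d}z_\mu^{-1}(1-b)^{l_b(d\mu)}(n/d)^{l(\mu)}.$$ In the special case $\gcd(b,d)=1$ we also have $l_b(d\mu)=l_b(\mu)$, and hence $$\genfrac{[}{]}{0pt}{}{n}{k}_\omega^{(b)}=\sum_{|\mu|=k/d}z_\mu^{-1}(1-b)^{l_b(\mu)}(n/d)^{l(\mu)}=\binom{n/d}{k/d}^{(b)}.$$ (b) If $d\mid(n-1)$ then $$\genfrac{[}{]}{0pt}{}{n}{k}_\omega^{(b)}=\sum_{|\lambda|=k}z_\lambda^{-1}(1-b)^{l_b(\lambda)}n^{l_d(\lambda)}.$$ (c) If $d\mid(n+1)$ then $$\omega^k\genfrac{[}{]}{0pt}{}{n}{k}_\omega^{(b)}=\sum_{|\lambda|=k}z_\lambda^{-1}(1-b)^{l_b(\lambda)}(-1)^{l(\lambda)-l_d(\lambda)}n^{l_d(\lambda)}.$$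
   Context: The integers $\binom{n}{k}^{(b)}$ are defined by $\sum_k\binom{n}{k}^{(b)}t^k=(1+t+\cdots+t^{b-1})^n$, and the polynomials $\genfrac{[}{]}{0pt}{}{n}{k}_q^{(b)}\in\mathbb{N}[q]$ by $\sum_k\genfrac{[}{]}{0pt}{}{n}{k}_q^{(b)}t^k=\prod_{i=0}^{n-1}(1+q^it+\cdots+(q^it)^{b-1})$; both are $0$ when $n$ or $k$ is not an integer, or when $k$ is outside the range of exponents occurring. $\genfrac{[}{]}{0pt}{}{n}{k}_\omega^{(b)}$ is the evaluation at $q=\omega$. Sums are over integer partitions $\lambda$ (or $\mu$) of the indicated weight; a sum over $|\mu|=k/d$ is empty (equal to $0$) if $k/d$ is not an integer. For a partition $\lambda=(\lambda_1\ge\lambda_2\ge\cdots)$: $|\lambda|=\sum_i\lambda_i$; $l(\lambda)$ is the number of nonzero parts; for an integer $c\ge1$, $l_c(\lambda)$ is the number of nonzero parts divisible by $c$; $m_i$ is the number of parts equal to $i$; $z_\lambda=\prod_{i\ge1}i^{m_i}\cdot m_i!$. $d\mu$ denotes the partition $(d\mu_1,d\mu_2,\ldots)$. *)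

(* Defs.v *)
From HB Require Import structures.
From mathcomp Require Import all_boot all_order all_algebra.

Set Implicit Arguments.
Unset Strict Implicit.
Unset Printing Implicit Defensive.

Import Order.TTheory GRing.Theory Num.Theory.
Local Open Scope ring_scope.

(* Coefficient of t^k in (1 + t + ... + t^(b-1))^n; indexing a polynomial
   beyond its size returns 0. *)
Definition gbinomn (b n k : nat) : nat :=
  (((\sum_(j < b) 'X^j) ^+ n : {poly nat})`_k)%R.

(* The same coefficient for rational arguments, 0 unless both are natural
   numbers. *)
Definition gbinom (b : nat) (x y : rat) : nat :=
  if (x \is a Num.nat) && (y \is a Num.nat)
  then gbinomn b (Num.truncn x) (Num.truncn y) else 0%N.

(* The q-analogue, a polynomial in q with coefficients in N. In
   {poly {poly nat}} the outer 'X is t and the inner one is q. *)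
Definition qgbinom (b n k : nat) : {poly nat} :=
  (\prod_(i < n) \sum_(j < b) (('X^i)%:P * 'X) ^+ j : {poly {poly nat}})`_k.

Definition qgbinom_eval (C : numClosedFieldType) (b n k : nat) (w : C) : C :=
  (map_poly (GRing.natmul (1 : C)) (qgbinom b n k)).[w].

Definition is_intpart (s : seq nat) : bool := sorted geq s && (0%N \notin s).

Record intpartn (m : nat) : predArgType := IntPartn {
  ipval :> seq nat;
  _ : is_intpart ipval && (sumn ipval == m)
}.

HB.instance Definition _ m := [isSub for @ipval m].
HB.instance Definition _ m := [Countable of intpartn m by <:].

Lemma intpartn_part m (lam : intpartn m) : all (geq m) lam.
Proof.
case: lam => s /= /andP[_ /eqP <-]; apply/allP => i.
elim: s => //= a s IH; rewrite inE => /orP[/eqP->|/IH]; first exact: leq_addr.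
by move=> h; apply: leq_trans h (leq_addl _ _).
Qed.

Lemma intpartn_size m (lam : intpartn m) : (size lam <= m)%N.
Proof.
case: lam => s /= /andP[/andP[_ s0] /eqP <-].
elim: s s0 => //= -[|a] s IH; rewrite inE //= => /IH h.
by rewrite addSn ltnS (leq_trans h) ?leq_addl.
Qed.

Definition intpartn_code m (lam : intpartn m) : m.-bseq 'I_m.+1 :=
  insub_bseq m [seq inord i | i <- lam].

Definition intpartn_decode m (t : m.-bseq 'I_m.+1) : option (intpartn m) :=
  insub [seq val i | i <- t].

Lemma intpartn_codeK m : pcancel (@intpartn_code m) (@intpartn_decode m).
Proof.
move=> lam; rewrite /intpartn_decode /intpartn_code /insub_bseq insubdK.
  rewrite -map_comp (_ : map _ _ = val lam) ?valK //.
  rewrite -[RHS]map_id; apply/eq_in_map => i i_lam /=.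
  by rewrite inordK // ltnS; exact: (allP (intpartn_part lam)).
by rewrite unfold_in /= size_map intpartn_size.
Qed.

HB.instance Definition _ m : isFinite (intpartn m) := PCanIsFinite (@intpartn_codeK m).

(* The following are applied to the parts of a partition or of its scaling by
   d > 0, which are positive: no zero part is counted. *)
Definition len (s : seq nat) : nat := size s.

Definition lenc (c : nat) (s : seq nat) : nat := count (fun i => c %| i)%N s.

Definition mult (i : nat) (s : seq nat) : nat := count_mem i s.

(* No part exceeds sumn s, and absent parts contribute a factor 1. *)
Definition zpart (s : seq nat) : nat :=
  (\prod_(1 <= i < (sumn s).+1) (i ^ mult i s * (mult i s)`!))%N.

Definition scale (d : nat) (s : seq nat) : seq nat := [seq (d * i)%N | i <- s].

(* Main.v *)
(* Both sides of each identity satisfy the same Newton recurrence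
   k c_k = \sum_(1 <= j <= k) a_j c_(k-j), which together with c_0 = 1 determines c.
   For \sum_(|lambda| = k) z_lambda^-1 \prod_i a_(lambda_i) the recurrence comes from
   removing a part j, because z_lambda = j m_j(lambda) z_mu when mu is lambda with one
   part j removed. For the product of the geometric sums
   (1 - (w^i t)^b) / (1 - w^i t) it is the logarithmic derivative, with
   a_j = (1 - b [b | j]) \sum_(i < n) w^(ij), and this power sum is n if d | j;
   otherwise it is 0, 1 or -w^-j according to whether d divides n, n - 1 or n + 1
   (the factor w^k in the last identity absorbs w^-j). *)

Require Import Defs.
From HB Require Import structures.
From mathcomp Require Import all_boot all_order all_algebra.

Set Implicit Arguments.
Unset Strict Implicit.
Unset Printing Implicit Defensive.

Import Order.TTheory GRing.Theory Num.Theory.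
Local Open Scope ring_scope.


(** * Newton's recurrence and operations preserving it *)

(* Logarithmic derivative in coefficients: if [c] is the coefficient sequence of
   exp (\sum_(j >= 1) a_j t^j / j), then t c' = c * \sum_(j >= 1) a_j t^j. *)
Definition newton (C : nzRingType) (a c : nat -> C) : Prop :=
  c 0%N = 1 /\
  forall k, c k.+1 *+ k.+1 = \sum_(j < k.+1) a j.+1 * c (k - j)%N.

Section Newton.

Variable C : numFieldType.
Implicit Types (a c : nat -> C) (P Q : {poly C}).

(** Each [c k.+1] is determined by the earlier values, because [k.+1] is invertible in
    characteristic 0. Only weights of positive index enter. *)
Lemma newton_unique a a' c c' :
  (forall j, a j.+1 = a' j.+1) -> newton a c -> newton a' c' -> c =1 c'.
Proof.
move=> eq_a [c0 cS] [c0' cS'] k.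
have [m] := ubnP k; elim: m k => // m IH [|k] lt_km; first by rewrite c0 c0'.
apply: (mulIf (x := k.+1%:R)); first by rewrite pnatr_eq0.
rewrite !mulr_natr cS cS'; apply: eq_bigr => j _.
by rewrite eq_a IH // (leq_ltn_trans (leq_subr _ _)).
Qed.

Lemma eq_newton a a' c c' :
  (forall j, a j.+1 = a' j.+1) -> c =1 c' -> newton a c -> newton a' c'.
Proof.
move=> eq_a eq_c [c0 cS]; split=> [|k]; rewrite -eq_c // cS.
by apply: eq_bigr => j _; rewrite eq_a eq_c.
Qed.

(** This is the substitution of xt for t in the generating function. *)
Lemma newton_scale a c x :
  newton a c -> newton (fun j => x ^+ j * a j) (fun k => x ^+ k * c k).
Proof.
move=> [c0 cS]; split=> [|k]; first by rewrite expr0 mul1r.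
rewrite -mulrnAr cS mulr_sumr; apply: eq_bigr => j _.
have -> : x ^+ k.+1 = x ^+ j.+1 * x ^+ (k - j).
  by rewrite -exprD addSn subnKC // -ltnS.
by rewrite mulrACA.
Qed.

Lemma newton_dvd_eq0 a c d k :
  (forall j, ~~ (d %| j)%N -> a j = 0) -> newton a c ->
  ~~ (d %| k)%N -> c k = 0.
Proof.
move=> a0 [_ cS].
have [m] := ubnP k; elim: m k => // m IH [|k] lt_km; first by rewrite dvdn0.
move=> ndk; apply: (mulIf (x := k.+1%:R)); first by rewrite pnatr_eq0.
rewrite mulr_natr cS mul0r big1 // => j _.
have [dj|/a0->] := boolP (d %| j.+1)%N; last by rewrite mul0r.
(* If d divides j + 1 but not k + 1, it does not divide the difference k - j. *)
rewrite IH ?mulr0 //; first by rewrite (leq_ltn_trans (leq_subr _ _)).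
apply: contra ndk => dkj.
by rewrite -(subnK (ltn_ord j)) subSS dvdn_addl.
Qed.

Lemma sum_dvd (f : nat -> C) d m : (0 < d)%N ->
  (forall j, ~~ (d %| j)%N -> f j = 0) ->
  \sum_(0 <= j < d * m) f j.+1 = \sum_(0 <= i < m) f (d * i.+1)%N.
Proof.
case: d => // d _ f0; elim: m => [|m IH]; first by rewrite muln0 !big_geq.
rewrite [RHS]big_nat_recr //= -IH mulnS addnC.
rewrite (@big_cat_nat _ _ _ (d.+1 * m)) ?leq_addr //=; congr (_ + _).
(* Here [d] is one less than the modulus. In the last block of [d.+1] indices only the final [j]
   makes [j.+1] a multiple of [d.+1]. *)
rewrite addnS big_nat_recr ?leq_addr //= big_nat_cond big1 ?add0r //.
move=> j /andP[/andP[lej ltj] _]; rewrite f0 //.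
rewrite -(subnKC lej) -addnS dvdn_addr ?dvdn_mulr //.
by rewrite gtnNdvd // ltnS ltn_subLR.
Qed.

(** With s = t^d, the exponent becomes the sum of a_(dj) s^j / (dj), so the weight attached to s^j /
    j is a_(dj) / d. *)
Lemma newton_dvd a c d :
  (0 < d)%N -> (forall j, ~~ (d %| j)%N -> a j = 0) -> newton a c ->
  newton (fun j => a (d * j)%N / d%:R) (fun k => c (d * k)%N).
Proof.
move=> d0 a0 [c0 cS]; split=> [|k]; first by rewrite muln0.
have dk0 : (0 < d * k.+1)%N by rewrite muln_gt0 d0.
have dC : d%:R != 0 :> C by rewrite pnatr_eq0 -lt0n.
apply: (mulfI dC); rewrite mulr_natl -mulrnA (mulnC k.+1) -{1 2}(prednK dk0) cS.
rewrite prednK //; under [in RHS]eq_bigr do rewrite mulrAC.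
rewrite -mulr_suml mulrC divfK //.
pose f j := a j * c (d * k.+1 - j)%N.
rewrite (eq_bigr (fun j : 'I_ _ => f j.+1)); last first.
  by move=> j _; rewrite /f -subSS prednK.
rewrite -(big_mkord xpredT (fun j => f j.+1)) sum_dvd //; last first.
  by move=> j /a0; rewrite /f => ->; rewrite mul0r.
by rewrite big_mkord; apply: eq_bigr => j _; rewrite /f -mulnBr subSS.
Qed.

(** The differential equation P' = A P, with A a power series, is stated for polynomials as a
    congruence modulo t^N for every N, with A truncated at N. *)
Lemma newtonE a P :
  newton a (fun k => P`_k) <->
  P`_0 = 1 /\ forall N, 'X^N %| P^`() - (\poly_(j < N) a j.+1) * P.
Proof.
have dvdXn N (R : {poly C}) :
    reflect (forall i, (i < N)%N -> R`_i = 0) ('X^N %| R).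
  rewrite /dvdp -Pdiv.IdomainMonic.take_poly_modp.
  apply: (iffP eqP) => [/polyP R0 i ltiN | R0].
    by have := R0 i; rewrite coef_take_poly ltiN coef0.
  by apply/polyP => i; rewrite coef_take_poly coef0; case: ifP => // /R0.
have coefMP N k : (k < N)%N ->
    ((\poly_(j < N) a j.+1) * P)`_k = \sum_(j < k.+1) a j.+1 * P`_(k - j).
  move=> ltkN; rewrite coefM; apply: eq_bigr => j _.
  by rewrite coef_poly (leq_trans (ltn_ord j)).
split=> -[c0 cS]; split=> //.
  move=> N; apply/dvdXn => i ltiN.
  by rewrite coefB coef_deriv cS coefMP // subrr.
move=> k; have /dvdXn/(_ k (ltnSn k)) := cS k.+1.
by rewrite coefB coef_deriv coefMP // => /subr0_eq.
Qed.

Lemma newtonM a b P Q :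
  newton a (fun k => P`_k) -> newton b (fun k => Q`_k) ->
  newton (fun j => a j + b j) (fun k => (P * Q)`_k).
Proof.
move=> /newtonE[P0 PS] /newtonE[Q0 QS]; apply/newtonE; split.
  by rewrite coefM big_ord1 P0 Q0 mulr1.
move=> N; rewrite derivM.
have -> : \poly_(j < N) (a j.+1 + b j.+1) =
    \poly_(j < N) a j.+1 + \poly_(j < N) b j.+1.
  by apply/polyP => i; rewrite coefD !coef_poly; case: ifP; rewrite ?addr0.
set A := \poly_(j < N) a j.+1; set B := \poly_(j < N) b j.+1.
(* By the Leibniz rule, the defect of the product is a combination of the two defects, each
   divisible by ['X^N]. *)
have -> : P^`() * Q + P * Q^`() - (A + B) * (P * Q) =
    (P^`() - A * P) * Q + (Q^`() - B * Q) * P.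
  rewrite !mulrBl mulrDl addrACA -opprD (mulrC P) !mulrA.
  by rewrite (mulrAC B P) .
by rewrite dvdp_add // dvdp_mulr.
Qed.

Lemma newton_prod n (a : nat -> nat -> C) (P : nat -> {poly C}) :
  (forall i, newton (a i) (fun k => (P i)`_k)) ->
  newton (fun j => \sum_(i < n) a i j) (fun k => (\prod_(i < n) P i)`_k).
Proof.
move=> aP; elim: n => [|n IH].
  split=> [|k]; first by rewrite big_ord0 coef1.
  by rewrite big_ord0 coef1 mul0rn big1 // => j _; rewrite big_ord0 mul0r.
apply: eq_newton (newtonM IH (aP n)) => j; first by rewrite big_ord_recr.
by rewrite big_ord_recr.
Qed.

(** * The recurrence for a geometric sum *)

Lemma sum_geom_weight b m : (0 < b)%N ->
  \sum_(0 <= j < m) (if (b %| j.+1)%N then 1 - b%:R else 1) = (m %% b)%:R :> C.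
Proof.
(* The partial sum grows by 1 at each step and drops back to 0 when [j.+1] is a multiple of b. *)
move=> b0; elim: m => [|m IH]; first by rewrite big_geq ?mod0n.
rewrite big_nat_recr //= IH modnS; case: ifP => [dvd_b|_]; last by rewrite natr1.
suff -> : (m %% b)%:R = b%:R - 1 :> C by rewrite addrA subrK subrr.
suff def_b : ((m %% b).+1 = b)%N by rewrite -[X in X%:R - 1]def_b -natr1 addrK.
apply/eqP; rewrite eqn_leq ltn_mod b0 dvdn_leq //.
by move: dvd_b; rewrite {1}(divn_eq m b) -addnS dvdn_addr // dvdn_mull.
Qed.

Definition geom b (x : C) : {poly C} := \sum_(j < b) (x%:P * 'X) ^+ j.

Lemma coef_geom b x k : (geom b x)`_k = if (k < b)%N then x ^+ k else 0.
Proof.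
have -> : geom b x = \poly_(j < b) x ^+ j.
  by rewrite poly_def; apply: eq_bigr => j _; rewrite exprMn -rmorphXn mul_polyC.
by rewrite coef_poly.
Qed.

(* The logarithm of the geometric sum (1 - (xt)^b) / (1 - xt) is
   \sum_j (xt)^j / j - \sum_j (xt)^(bj) / j. *)
Lemma newton_geom b x : (0 < b)%N ->
  newton (fun j => (if (b %| j)%N then 1 - b%:R else 1) * x ^+ j)
         (fun k => (geom b x)`_k).
Proof.
move=> b0; split=> [|k]; first by rewrite coef_geom b0.
pose u j : C := if (b %| j.+1)%N then 1 - b%:R else 1.
(* All powers of x combine to x^(k+1); the support of [geom] leaves only the weights with k - j <
   b. *)
transitivity (x ^+ k.+1 * \sum_(0 <= j < k.+1 | (k - j < b)%N) u j); last first.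
  rewrite big_mkord big_mkcond mulr_sumr; apply: eq_bigr => j _.
  rewrite coef_geom /u; case: ifP => _; last by rewrite !mulr0.
  by rewrite -mulrA -exprD addSn subnKC 1?mulrC // -ltnS.
have sumE m : \sum_(0 <= j < m) u j = (m %% b)%:R by exact: sum_geom_weight.
rewrite coef_geom; have [ltkb|lebk] := ltnP k b.
  rewrite [X in _ = _ * X](_ : _ = \sum_(0 <= j < k.+1) u j); last first.
    by apply: eq_bigl => j; rewrite (leq_ltn_trans (leq_subr _ _) ltkb).
  (* For k < b every weight is present; the sum is k + 1, except that it is 0 when k + 1 = b. *)
  rewrite sumE; move: ltkb; rewrite leq_eqVlt => /predU1P[<-|lt].
    by rewrite ltnn modnn mulr0 mul0rn.
  by rewrite lt modn_small // mulr_natr.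
rewrite ltnNge (leq_trans lebk) //= mul0rn.
(* For b <= k the remaining indices form a window of b consecutive weights. Its sum is a difference
   of two partial sums whose lengths agree modulo b. *)
suff -> : \sum_(0 <= j < k.+1 | (k - j < b)%N) u j = 0 by rewrite mulr0.
rewrite (_ : \sum_(_ <= _ < _ | _) _ = \sum_((k - b).+1 <= j < k.+1) u j); last first.
  rewrite [RHS](big_nat_widenl _ 0) // [LHS]big_nat_cond [RHS]big_nat_cond.
  apply: eq_bigl => j /=; case: (ltnP j k.+1) => //= lejk.
  by rewrite !ltn_subLR // addnC.
apply: (addrI ((k - b).+1 %% b)%:R); rewrite -[in LHS]sumE.
rewrite -big_cat_nat ?ltnS ?leq_subr //=.
by rewrite sumE addr0 -{1}(subnK lebk) -addSn modnDr.
Qed.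

End Newton.

(** * Multiplicities and z of a partition *)

Lemma mult_gt_sumn i s : (sumn s < i)%N -> mult i s = 0%N.
Proof.
elim: s => //= x s IH lt_i; rewrite /mult /= -/(mult i s) IH.
  by rewrite addn0; case: eqP lt_i => // ->; rewrite ltnNge leq_addr.
by apply: leq_ltn_trans lt_i; rewrite leq_addl.
Qed.

Lemma zpart_widen s N : (sumn s <= N)%N ->
  zpart s = (\prod_(1 <= i < N.+1) (i ^ mult i s * (mult i s)`!))%N.
Proof.
move=> leN; rewrite [RHS](@big_cat_nat _ _ _ (sumn s).+1) //=.
rewrite [X in (_ * X)%N]big_nat_cond [X in (_ * X)%N]big1 ?muln1 //.
by move=> i /andP[/andP[lt_i _] _]; rewrite mult_gt_sumn // expn0 mul1n fact0.
Qed.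

(** Only the factor at i + 1 changes: its multiplicity m becomes m + 1, which contributes one more i
    + 1 to the power and m + 1 to the factorial. *)
Lemma zpart_cons i s :
  zpart (i.+1 :: s) = (zpart s * (i.+1 * (mult i.+1 s).+1))%N.
Proof.
rewrite (@zpart_widen s (i.+1 + sumn s)) ?leq_addl // /zpart /=.
have i_in : i.+1 \in index_iota 1 (i.+1 + sumn s).+1.
  by rewrite mem_index_iota /= ltnS leq_addr.
rewrite !(bigD1_seq i.+1) ?iota_uniq //=.
rewrite /mult /= eqxx add1n expnS factS.
under [in LHS]eq_bigr => j ne_ji do rewrite eq_sym (negPf ne_ji) add0n.
by rewrite -/(mult _ _) [RHS]mulnAC; congr (_ * _)%N; rewrite [RHS]mulnC mulnACA.
Qed.

Lemma perm_zpart s t : perm_eq s t -> zpart s = zpart t.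
Proof.
move=> st; rewrite /zpart (perm_sumn st); apply: eq_bigr => i _.
by rewrite /mult (permP st).
Qed.

Lemma sumn_mult s N : 0%N \notin s -> (sumn s <= N)%N ->
  sumn s = (\sum_(j < N) j.+1 * mult j.+1 s)%N.
Proof.
move=> s0 leN; elim: s s0 leN => [|[|x] s IH] /= s0 leN.
- by rewrite big1 // => j _; rewrite muln0.
- by [].
have ltxN : (x < N)%N by apply: leq_trans leN; rewrite addSn ltnS leq_addr.
rewrite {1}IH; [|exact: s0|by apply: leq_trans leN; rewrite leq_addl].
rewrite [RHS](eq_bigr (fun j : 'I_N => (if j == Ordinal ltxN then x.+1 else 0%N)
  + j.+1 * mult j.+1 s)%N) => [|j _].
  by rewrite [RHS]big_split -big_mkcond big_pred1_eq.
rewrite -val_eqE /= mulnDr eqSS eq_sym; congr (_ + _)%N.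
by case: eqP => [->|_]; rewrite ?muln1 ?muln0.
Qed.

Lemma intpart_inj k (lam mu : intpartn k) : perm_eq lam mu -> lam = mu.
Proof.
move=> pe; apply/val_inj; move: pe.
case: lam mu => s /= /andP[/andP[ss _] _] [t /= /andP[/andP[st _] _]].
apply: sorted_eq ss st => [x y z xy yz|x y]; first exact: leq_trans yz xy.
by move=> /andP[xy yx]; apply/eqP; rewrite eqn_leq; apply/andP.
Qed.

(** * Adding and removing one part *)

Section AddPart.

Variables (i m : nat).

Lemma addpart_subproof (mu : intpartn m) :
  is_intpart (sort geq (i.+1 :: mu)) && (sumn (sort geq (i.+1 :: mu)) == i.+1 + m)%N.
Proof.
case: mu => s /= /andP[/andP[_ s0] /eqP <-].
have ps : perm_eq (sort geq (i.+1 :: s)) (i.+1 :: s) by rewrite perm_sort.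
rewrite /is_intpart sort_sorted => [|x y]; last exact: leq_total.
by rewrite (perm_mem ps) inE negb_or s0 (perm_sumn ps) eqxx.
Qed.

Definition addpart mu : intpartn (i.+1 + m) := IntPartn (addpart_subproof mu).

Lemma perm_addpart mu : perm_eq (addpart mu) (i.+1 :: mu).
Proof. by rewrite perm_sort. Qed.

Lemma rempart_subproof (lam : intpartn (i.+1 + m)) : i.+1 \in val lam ->
  is_intpart (rem i.+1 lam) && (sumn (rem i.+1 lam) == m).
Proof.
case: lam => s /= /andP[/andP[ss s0] /eqP sum_s] i_s.
have ps := perm_to_rem i_s; rewrite /is_intpart.
rewrite (subseq_sorted _ (rem_subseq _ _)) //; last first.
  by move=> x y z /= xy yz; exact: leq_trans yz xy.
rewrite (contra (@mem_rem _ _ _ _)) //=.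
by rewrite -(eqn_add2l i.+1) -sum_s (perm_sumn ps).
Qed.

(** Inserting a part i + 1 is a bijection onto the partitions containing that part; its inverse
    removes one occurrence. Sorted lists make the partition unique up to permutation. *)
Lemma reindex_addpart (V : nmodType) (F : intpartn (i.+1 + m) -> V) :
  \sum_(lam : intpartn (i.+1 + m) | i.+1 \in val lam) F lam =
  \sum_(mu : intpartn m) F (addpart mu).
Proof.
pose rempart (lam : intpartn (i.+1 + m)) : option (intpartn m) :=
  insub (rem i.+1 (val lam)).
rewrite (reindex_omap addpart rempart) => [|lam i_lam].
  apply: eq_bigl => mu; rewrite (perm_mem (perm_addpart mu)) mem_head /=.
  have i_mu : i.+1 \in val (addpart mu).
    by rewrite (perm_mem (perm_addpart mu)) mem_head.
  rewrite /rempart insubT ?rempart_subproof // => lt_mu.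
  apply/eqP; congr Some; apply: intpart_inj => /=.
  rewrite -(perm_cons i.+1) -(permPr (perm_addpart mu)) perm_sym.
  exact: perm_to_rem.
rewrite /rempart insubT ?rempart_subproof //= => lt_lam; congr Some.
apply: intpart_inj; rewrite (permPl (perm_addpart _)) /= perm_sym.
exact: perm_to_rem.
Qed.

End AddPart.

(** * Weighted sums over partitions *)

Section PartitionSum.

Variable C : numFieldType.

Definition part_sum (a : nat -> C) (k : nat) : C :=
  \sum_(lam : intpartn k) (zpart lam)%:R^-1 * \prod_(i <- lam) a i.

(** Partitions without the part i + 1 contribute 0. For the others, the factor (i + 1) times the
    multiplicity cancels what [zpart_cons] adds to z. *)
Lemma part_sum_mult a i m :
  \sum_(lam : intpartn (i.+1 + m))
    (zpart lam)%:R^-1 * \prod_(x <- lam) a x * (i.+1 * mult i.+1 lam)%:R =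
  a i.+1 * part_sum a m.
Proof.
rewrite (bigID (fun lam : intpartn _ => i.+1 \in val lam)) /= addrC big1 ?add0r.
  rewrite reindex_addpart mulr_sumr; apply: eq_bigr => mu _.
  rewrite (perm_zpart (perm_addpart i mu)) (perm_big _ (perm_addpart i mu)) /=.
  rewrite /mult (permP (perm_addpart i mu)) big_cons zpart_cons /= eqxx add1n.
  rewrite -/(mult _ _) natrM invfM mulrCA -!mulrA; congr (_ * (_ * _)).
  by rewrite mulrC mulfK // pnatr_eq0.
by move=> lam /count_memPn; rewrite /mult => ->; rewrite muln0 mulr0.
Qed.

Lemma newton_part_sum a : newton a (part_sum a).
Proof.
split=> [|k].
  have part0 : is_intpart [::] && (sumn [::] == 0)%N by [].
  rewrite /part_sum (big_pred1 (IntPartn part0)) => [|lam].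
    by rewrite big_nil /zpart big_geq // invr1 mulr1.
  rewrite /=; symmetry; apply/eqP/val_inj/size0nil/eqP.
  by rewrite -leqn0 intpartn_size.
rewrite /part_sum -sumrMnl.
(* The factor k + 1 is the weight of [lam], written as the sum of its part sizes times their
   multiplicities. *)
transitivity (\sum_(lam : intpartn k.+1) \sum_(j < k.+1)
    (zpart lam)%:R^-1 * \prod_(x <- lam) a x * (j.+1 * mult j.+1 lam)%:R).
  apply: eq_bigr => lam _; rewrite -mulr_sumr -natr_sum.
  have [/andP[_ s0] /eqP sum_lam] := andP (valP lam).
  by rewrite -sumn_mult ?sum_lam // mulr_natr.
rewrite exchange_big; apply: eq_bigr => j _ /=.
rewrite -part_sum_mult.
(* The two sums range over different types until their indices are identified. *)
have : (j.+1 + (k - j) = k.+1)%N by rewrite addSn subnKC // -ltnS.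
by move=> ->.
Qed.

(** The second exponent is kept as a difference, to match l - l_d in the case of d dividing n +
    1. *)
Lemma prod_count (I : Type) (s : seq I) (P : pred I) (x y : C) :
  \prod_(i <- s) (if P i then x else y) =
  x ^+ count P s * y ^+ (size s - count P s).
Proof.
have -> : (size s - count P s = count (predC P) s)%N.
  by rewrite -(count_predC P) addKn.
elim: s => [|i s IH]; first by rewrite big_nil !expr0 mulr1.
by rewrite big_cons IH /=; case: (P i); rewrite add0n add1n exprS !mulrA // (mulrC y).
Qed.

(** A weight vanishing off the multiples of d restricts a partition sum to partitions with all parts
    divisible by d. *)
Lemma prod_all (I : Type) (s : seq I) (P : pred I) (x : C) :
  \prod_(i <- s) (if P i then x else 0) = if all P s then x ^+ size s else 0.
Proof.
elim: s => [|i s IH]; first by rewrite big_nil.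
rewrite big_cons IH /=; case: (P i); rewrite ?mul0r //.
by case: ifP; rewrite ?mulr0 ?exprS.
Qed.

End PartitionSum.

(** * Power sums of the first n powers of a root of unity *)

Section RootOfUnity.

Variables (C : fieldType) (n d : nat) (w : C).
Hypothesis hw : d.-primitive_root w.

Definition power_sum (j : nat) : C := \sum_(i < n) (w ^+ i) ^+ j.

Lemma power_sum_dvd j : (d %| j)%N -> power_sum j = n%:R.
Proof.
rewrite (prim_order_dvd hw) => /eqP wj1; rewrite /power_sum.
by under eq_bigr do rewrite exprAC wj1 expr1n; rewrite sumr_const card_ord.
Qed.

(** A finite geometric series of ratio w^j; the factor w^j - 1 can be cancelled when d does not
    divide j. *)
Lemma power_sum_geom j : (w ^+ j - 1) * power_sum j = w ^+ (j * n) - 1.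
Proof.
by rewrite exprM [RHS]subrX1; congr (_ * _); apply: eq_bigr => i _; rewrite exprAC.
Qed.

Lemma root_sub1_neq0 j : ~~ (d %| j)%N -> w ^+ j - 1 != 0.
Proof. by rewrite (prim_order_dvd hw) subr_eq0. Qed.

Lemma power_sum_dvdn j : (d %| n)%N -> ~~ (d %| j)%N -> power_sum j = 0.
Proof.
move=> dn /root_sub1_neq0 w1; apply: (mulfI w1); rewrite power_sum_geom mulr0.
by apply/eqP; rewrite subr_eq0 -(prim_order_dvd hw) dvdn_mull.
Qed.

(** Here w^(jn) = w^j, so both sides of the geometric identity equal w^j - 1. Positivity of n makes
    the truncated [n - 1] a true predecessor. *)
Lemma power_sum_dvdn_sub1 j :
  (0 < n)%N -> (d %| n - 1)%N -> ~~ (d %| j)%N -> power_sum j = 1.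
Proof.
move=> n0 dn /root_sub1_neq0 w1; apply: (mulfI w1); rewrite power_sum_geom mulr1.
congr (_ - 1); rewrite -{1}(subnK n0) mulnDr muln1 exprD.
by rewrite (eqP (_ : w ^+ _ == 1)) ?mul1r // -(prim_order_dvd hw) dvdn_mull.
Qed.

Lemma power_sum_dvdn_add1 j :
  (d %| n + 1)%N -> ~~ (d %| j)%N -> w ^+ j * power_sum j = -1.
Proof.
move=> dn /root_sub1_neq0 w1; apply: (mulfI w1).
(* The numerator is w^j (w^(jn) - 1) = w^(j(n+1)) - w^j = 1 - w^j. *)
rewrite mulrCA power_sum_geom mulrBr -exprD -mulnS mulr1 mulrN1 opprB.
by congr (_ - _); apply/eqP; rewrite -(prim_order_dvd hw) -addn1 dvdn_mull.
Qed.

End RootOfUnity.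

(** * Both coefficients as coefficients of products of geometric sums *)

Lemma qgbinom_evalE (C : numClosedFieldType) b n k (w : C) :
  qgbinom_eval b n k w = (\prod_(i < n) geom b (w ^+ i))`_k.
Proof.
(* Evaluation at q = w is a semiring morphism, so it commutes with extracting the coefficient of
   t^k. *)
pose ev : {rmorphism {poly nat} -> C} :=
  (horner_eval w \o map_poly (GRing.natmul (1 : C)))%FUN.
rewrite (_ : qgbinom_eval b n k w = ev (qgbinom b n k)) // /qgbinom -coef_map.
rewrite rmorph_prod (eq_bigr (fun i : 'I_n => geom b (w ^+ i))) // => i _.
rewrite rmorph_sum; apply: eq_bigr => j _ /=.
rewrite rmorphXn rmorphM /= map_polyX map_polyC /=.
by rewrite map_polyXn horner_evalE hornerXn.
Qed.

Lemma gbinomnE (C : numFieldType) b n k :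
  (gbinomn b n k)%:R = (\prod_(i < n) geom b (1 : C))`_k.
Proof.
rewrite /gbinomn -(coef_map (GRing.natmul (1 : C))) rmorphXn rmorph_sum /=.
rewrite prodr_const card_ord /geom; under eq_bigr do rewrite map_polyXn.
by under [in RHS]eq_bigr do rewrite mul1r.
Qed.

(** * Comparison of recurrences and the resulting expansions *)

Section Expansion.

Variables (C : numClosedFieldType) (b n d : nat) (w : C).
Hypotheses (b_gt0 : (0 < b)%N) (d_gt0 : (0 < d)%N).
Hypothesis hw : d.-primitive_root w.

Let wt (j : nat) : C := if (b %| j)%N then 1 - b%:R else 1.

Lemma prod_wt (s : seq nat) : \prod_(i <- s) wt i = (1 - b%:R) ^+ lenc b s.
Proof. by rewrite prod_count expr1n mulr1. Qed.

Lemma newton_qgbinom_eval :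
  newton (fun j => wt j * power_sum n w j) (fun k => qgbinom_eval b n k w).
Proof.
apply: eq_newton (newton_prod n (fun i => newton_geom (w ^+ i) b_gt0)).
  by move=> j; rewrite -mulr_sumr.
by move=> k; rewrite qgbinom_evalE.
Qed.

Lemma newton_gbinomn m :
  newton (fun j => wt j * m%:R) (fun k => (gbinomn b m k)%:R).
Proof.
apply: eq_newton (newton_prod m (fun i => newton_geom 1 b_gt0)).
  by move=> j; rewrite -mulr_sumr expr1n sumr_const card_ord.
by move=> k; rewrite gbinomnE.
Qed.

Lemma newton_qgbinom_eval_dvd : (d %| n)%N ->
  newton (fun j => wt j * (if (d %| j)%N then n%:R else 0))
         (fun k => qgbinom_eval b n k w).
Proof.
move=> dn; apply: eq_newton newton_qgbinom_eval => // j.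
case: ifPn => dj; first by rewrite (power_sum_dvd n hw).
by rewrite (power_sum_dvdn hw).
Qed.

Lemma qgbinom_eval_dvd k : (d %| n)%N ->
  qgbinom_eval b n k w =
    \sum_(lam : intpartn k | all (fun i => d %| i)%N lam)
      (zpart lam)%:R^-1 * (1 - b%:R) ^+ lenc b lam * n%:R ^+ len lam.
Proof.
move=> dn; have nq := newton_qgbinom_eval_dvd dn.
rewrite (newton_unique (fun j => erefl) nq (newton_part_sum _)) /part_sum.
rewrite [RHS]big_mkcond; apply: eq_bigr => lam _.
rewrite big_split prod_wt prod_all /= mulrA.
by case: ifP; rewrite ?mulr0.
Qed.

Lemma qgbinom_eval_ndvd k : (d %| n)%N -> ~~ (d %| k)%N ->
  qgbinom_eval b n k w = 0.
Proof.
move=> dn; apply: newton_dvd_eq0 (newton_qgbinom_eval_dvd dn) => j /negPf ->.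
by rewrite mulr0.
Qed.

Lemma newton_qgbinom_eval_scale : (d %| n)%N ->
  newton (fun j => wt (d * j)%N * (n%:R / d%:R))
         (fun k => qgbinom_eval b n (d * k) w).
Proof.
move=> dn; have nq := newton_qgbinom_eval_dvd dn.
apply: eq_newton (newton_dvd d_gt0 _ nq) => // j.
  by rewrite dvdn_mulr // mulrA.
by move/negPf->; rewrite mulr0.
Qed.

Lemma qgbinom_eval_scale k : (d %| n)%N ->
  qgbinom_eval b n k w =
    \sum_(mu : intpartn (k %/ d) | (d %| k)%N)
      (zpart mu)%:R^-1 * (1 - b%:R) ^+ lenc b (scale d mu)
      * (n%:R / d%:R) ^+ len mu.
Proof.
move=> dn; have [dk|ndk] := boolP (d %| k)%N; last first.
  by rewrite big_pred0 ?qgbinom_eval_ndvd // => mu; apply/negbTE.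
have nq := newton_qgbinom_eval_scale dn.
rewrite -{1}(divnK dk) mulnC.
rewrite (newton_unique (fun j => erefl) nq (newton_part_sum _)) /part_sum.
apply: eq_bigr => mu _; rewrite big_split /= -mulrA; congr (_ * (_ * _)).
  by rewrite -prod_wt big_map.
by rewrite big_const_seq count_predT iter_mulr_1.
Qed.

Lemma lenc_scale (s : seq nat) : coprime b d -> lenc b (scale d s) = lenc b s.
Proof.
by move=> bd; rewrite /lenc count_map; apply: eq_count => i /=; rewrite Gauss_dvdr.
Qed.

(** By coprimality b divides dj exactly when it divides j, so both sequences have the weights of (1
    + t + ... + t^(b-1))^(n/d). *)
Lemma qgbinom_eval_gbinomn k : (d %| n)%N -> coprime b d ->
  qgbinom_eval b n (d * k) w = (gbinomn b (n %/ d) k)%:R.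
Proof.
move=> dn bd; move: k.
apply: newton_unique (newton_qgbinom_eval_scale dn) (newton_gbinomn _) => j.
congr (_ * _); first by rewrite /wt Gauss_dvdr.
by rewrite -{1}(divnK dn) natrM mulfK // pnatr_eq0 -lt0n.
Qed.

Lemma qgbinom_eval_gbinom k : (d %| n)%N -> coprime b d ->
  qgbinom_eval b n k w = (gbinom b (n%:Q / d%:Q) (k%:Q / d%:Q))%:R.
Proof.
move=> dn bd; rewrite /gbinom.
have dQ : d%:Q != 0 by rewrite intr_eq0 -lt0n.
have divQ m : (d %| m)%N -> m%:Q / d%:Q = (m %/ d)%:R.
  by move=> dm; rewrite -{1}(divnK dm) PoszM intrM mulfK.
rewrite divQ // natr_nat natrK /=.
have [dk|ndk] := boolP (d %| k)%N.
  by rewrite divQ // natr_nat natrK -qgbinom_eval_gbinomn // mulnC divnK.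
(* If d does not divide k, both sides vanish: k/d is not a natural number. *)
rewrite qgbinom_eval_ndvd //; case: ifP => // /natrP[m km].
case/negP: ndk; apply/dvdnP; exists m; apply/eqP.
rewrite -eqz_nat -(eqr_int rat) PoszM intrM -[m%:~R]/(m%:R) -km.
by rewrite divfK.
Qed.

Lemma qgbinom_eval_dvd_sub1 k : (0 < n)%N -> (d %| n - 1)%N ->
  qgbinom_eval b n k w =
    \sum_(lam : intpartn k)
      (zpart lam)%:R^-1 * (1 - b%:R) ^+ lenc b lam * n%:R ^+ lenc d lam.
Proof.
move=> n0 dn; have nq := newton_qgbinom_eval.
rewrite (newton_unique (a' := fun j => wt j * (if (d %| j)%N then n%:R else 1))
  _ nq (newton_part_sum _)) => [|j].
  apply: eq_bigr => lam _.
  by rewrite big_split prod_wt prod_count /= expr1n mulr1 mulrA.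
case: ifPn => dj; first by rewrite (power_sum_dvd n hw).
by rewrite (power_sum_dvdn_sub1 hw).
Qed.

Lemma qgbinom_eval_dvd_add1 k : (d %| n + 1)%N ->
  w ^+ k * qgbinom_eval b n k w =
    \sum_(lam : intpartn k)
      (zpart lam)%:R^-1 * (1 - b%:R) ^+ lenc b lam
      * (-1) ^+ (len lam - lenc d lam) * n%:R ^+ lenc d lam.
Proof.
(* Scaling by w turns the power sum p_j into w^j p_j, which is n on multiples of d and -1
   elsewhere. *)
move=> dn; have nq := newton_scale w newton_qgbinom_eval.
rewrite (newton_unique (a' := fun j => wt j * (if (d %| j)%N then n%:R else -1))
  _ nq (newton_part_sum _)) => [|j].
  apply: eq_bigr => lam _.
  by rewrite big_split prod_wt prod_count /= [X in _ * (_ * X)]mulrC !mulrA.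
rewrite mulrCA; congr (_ * _).
case: ifPn => dj; last by rewrite (power_sum_dvdn_add1 hw).
rewrite (power_sum_dvd n hw) //.
by move: dj; rewrite (prim_order_dvd hw) => /eqP->; rewrite mul1r.
Qed.

End Expansion.

Theorem corollary5p3 (C : numClosedFieldType) (b n d k : nat) (w : C)
    (hb : (2 <= b)%N) (hn : (1 <= n)%N) (hd : (1 <= d)%N)
    (hw : d.-primitive_root w) :
  [/\ (d %| n)%N ->
      [/\ qgbinom_eval b n k w =
            \sum_(lam : intpartn k | all (fun i => d %| i)%N lam)
              (zpart lam)%:R^-1 * (1 - b%:R) ^+ lenc b lam * n%:R ^+ len lam,
          qgbinom_eval b n k w =
            \sum_(mu : intpartn (k %/ d) | (d %| k)%N)
              (zpart mu)%:R^-1 * (1 - b%:R) ^+ lenc b (scale d mu)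
              * (n%:R / d%:R) ^+ len mu
        & coprime b d ->
          [/\ forall (m : nat) (mu : intpartn m),
                lenc b (scale d mu) = lenc b mu,
              qgbinom_eval b n k w =
                \sum_(mu : intpartn (k %/ d) | (d %| k)%N)
                  (zpart mu)%:R^-1 * (1 - b%:R) ^+ lenc b mu
                  * (n%:R / d%:R) ^+ len mu
            & qgbinom_eval b n k w =
                (gbinom b (n%:Q / d%:Q) (k%:Q / d%:Q))%:R]],
      (d %| n - 1)%N ->
        qgbinom_eval b n k w =
          \sum_(lam : intpartn k)
            (zpart lam)%:R^-1 * (1 - b%:R) ^+ lenc b lam * n%:R ^+ lenc d lam
    & (d %| n + 1)%N ->
        w ^+ k * qgbinom_eval b n k w =
          \sum_(lam : intpartn k)
            (zpart lam)%:R^-1 * (1 - b%:R) ^+ lenc b lam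
            * (-1) ^+ (len lam - lenc d lam) * n%:R ^+ lenc d lam].
Proof.
have b0 : (0 < b)%N by exact: ltnW.
split=> dn; last exact: qgbinom_eval_dvd_add1.
  split=> [||bd]; [exact: qgbinom_eval_dvd|exact: qgbinom_eval_scale|].
  split=> [m mu||]; [exact: lenc_scale| |exact: qgbinom_eval_gbinom].
  rewrite (qgbinom_eval_scale b0 hd hw) //; apply: eq_bigr => mu _.
  by rewrite lenc_scale.
exact: qgbinom_eval_dvd_sub1.
Qed.
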